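(* Let $\mathbf{M}\subseteq\Sigma^*$ be a regular language and let $\mathbf{t}$ be an input-decreasing transducer over $\Sigma$ (with respect to a fixed total order $\prec$ on $\Sigma^*$ as in the context). If a language $L$ is regular, then $\mu^iL$ is regular for every $i\in\mathbb{N}$, and a finite automaton accepting $\mu^iL$ can be effectively computed from any finite automaton accepting $L$. Consequently, if there is an index $i$ such that $\mu^*L=\mu^iL$ for all $\mathbf{t}$-independent languages $L\subseteq\mathbf{M}$, then there is an algorithm that, given a finite automaton accepting a $\mathbf{t}$-independent regular language $L\subseteq\mathbf{M}$, computes a finite automaton accepting a regular language that contains $L$ and is maximal $\mathbf{t}$-independent (relative to $\mathbf{M}$).
   Context: $\mathbb{N}$ is the set of positive integers. $\Sigma$ is an alphabet (finite nonempty set) and $\Sigma^*$ is the set of all words over it. Fix a total order $\prec$ (strict) on $\Sigma^*$ such that every word $w$ has a position $\mathrm{pos}(w)\in\{0,1,2,\ldots\}$, the number of words strictly smaller than $w$. A transducer $\mathbf{t}$ over $\Sigma$ is a finite transducer $(Q,\Sigma,T,I,F)$ with finite transition set $T\subseteq Q\times\Sigma^*\times\Sigma^*\times Q$ and sets $I,F\subseteq Q$ of initial and final states; it realizes the relation $R(\mathbf{t})\subseteq\Sigma^*\times\Sigma^*$ of labels of its accepting paths. Write $y\in\mathbf{t}(x)$ iff $(x,y)\in R(\mathbf{t})$, $\mathbf{t}(X)=\bigcup_{x\in X}\mathbf{t}(x)$ for a language $X$, and $\mathbf{t}^{-1}$ for the transducer realizing the inverse relation. $\mathbf{t}$ is input-decreasing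 if $y\in\mathbf{t}(x)$ implies $y\prec x$, for all words $x,y$. A language $L$ is $\mathbf{t}$-independent if $\mathbf{t}(L)\cap L=\emptyset$. A $\mathbf{t}$-independent $L\subseteq\mathbf{M}$ is maximal $\mathbf{t}$-independent (relative to $\mathbf{M}$) if $L\cup\{w\}$ is not $\mathbf{t}$-independent for every $w\in\mathbf{M}\setminus L$. For any language $X$: $\mathrm{I}(X)=\mathbf{M}\setminus(\mathbf{t}(X)\cup\mathbf{t}^{-1}(X))$ and $\mu X=\mathrm{I}(X)\setminus\mathbf{t}^{-1}(\mathrm{I}(X))$. Moreover $\mu^0X=X$, $\mu^{i+1}X=\mu(\mu^iX)$ and $\mu^*X=\bigcup_{i\ge0}\mu^iX$. *)

(* Defs.v *)
From HB Require Import structures.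
From mathcomp Require Import all_boot.
From mathcomp Require Import boolp classical_sets cardinality.

Set Implicit Arguments.
Unset Strict Implicit.
Unset Printing Implicit Defensive.

Local Open Scope classical_set_scope.

(* Kleene's partial recursive functions.  Arities are not recorded in the
   syntax: [RZero] and [RProj i] stand for the constant and the projections of
   every sufficient arity, and where arities do not match [eval] gives no
   value. *)
Inductive recfun : Type :=
| RZero
| RSucc
| RProj of nat
| RComp of recfun & seq recfun
| RRec of recfun & recfun
| RMin of recfun.

(* [RRec f g] recurses on its first argument, with base case [f xs] and step
   [g n (value at n) xs]; [RMin f] is unbounded minimisation. *)
Inductive eval : recfun -> seq nat -> nat -> Prop :=
| eval_zero xs : eval RZero xs 0
| eval_succ x : eval RSucc [:: x] x.+1
| eval_proj i xs : i < size xs -> eval (RProj i) xs (nth 0 xs i)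
| eval_comp f gs xs ys z :
    evals gs xs ys -> eval f ys z -> eval (RComp f gs) xs z
| eval_rec0 f g xs y : eval f xs y -> eval (RRec f g) (0 :: xs) y
| eval_recS f g n xs y z :
    eval (RRec f g) (n :: xs) y -> eval g [:: n, y & xs] z ->
    eval (RRec f g) (n.+1 :: xs) z
| eval_min f xs n (v : nat -> nat) :
    (forall m, m < n -> eval f (m :: xs) (v m).+1) ->
    eval f (n :: xs) 0 -> eval (RMin f) xs n
with evals : seq recfun -> seq nat -> seq nat -> Prop :=
| evals_nil xs : evals [::] xs [::]
| evals_cons g gs xs y ys :
    eval g xs y -> evals gs xs ys -> evals (g :: gs) xs (y :: ys).

(* There is an algorithm which, given any [x] satisfying [P], halts with some
   [y] such that [R x y].  Inputs and outputs are coded by the numbering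
   [pickle] of their countable types, so this is meaningful only for types
   whose [pickle] is itself effective, such as those built from [nat] and
   finite types by products and sequences. *)
Definition algorithm (aT bT : countType) (P : aT -> Prop)
    (R : aT -> bT -> Prop) : Prop :=
  exists e : recfun, forall x, P x ->
    exists2 y, eval e [:: pickle x] (pickle y) & R x y.

(* States are natural numbers, so that an automaton is a finite piece of data
   on which an algorithm can operate; the state set is the finite set of
   numbers occurring in the three lists. *)
Record nfa (Sigma : finType) : Type := NFA {
  nfa_trans : seq (nat * Sigma * nat);
  nfa_init : seq nat;
  nfa_final : seq nat }.

Section NfaCountable.
Variable Sigma : finType.

Definition nfa_tuple (A : nfa Sigma) :=
  (nfa_trans A, nfa_init A, nfa_final A).
Definition tuple_nfa (x : seq (nat * Sigma * nat) * seq nat * seq nat) :=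
  NFA x.1.1 x.1.2 x.2.
Lemma nfa_tupleK : cancel nfa_tuple tuple_nfa. Proof. by case. Qed.

HB.instance Definition _ := Countable.copy (nfa Sigma) (can_type nfa_tupleK).
End NfaCountable.

Fixpoint nfa_path (Sigma : finType) (A : nfa Sigma) (p : nat)
    (w : seq Sigma) (q : nat) : Prop :=
  if w is a :: w' then
    exists2 r, (p, a, r) \in nfa_trans A & nfa_path A r w' q
  else p = q.

Definition lang (Sigma : finType) (A : nfa Sigma) : set (seq Sigma) :=
  [set w | exists p q, [/\ p \in nfa_init A, q \in nfa_final A
                         & nfa_path A p w q]].

Definition regular (Sigma : finType) (L : set (seq Sigma)) : Prop :=
  exists A : nfa Sigma, lang A = L.

Record transducer (Sigma : finType) : Type := Transducer {
  tstate : finType;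
  ttrans : seq (tstate * seq Sigma * seq Sigma * tstate);
  tinit : {set tstate};
  tfinal : {set tstate} }.

Inductive tpath (Sigma : finType) (t : transducer Sigma) :
  tstate t -> seq Sigma -> seq Sigma -> tstate t -> Prop :=
| tpath_nil p : tpath p [::] [::] p
| tpath_cons p u v q x y r : (p, u, v, q) \in ttrans t ->
    tpath q x y r -> tpath p (u ++ x) (v ++ y) r.

Definition realizes (Sigma : finType) (t : transducer Sigma)
    (x y : seq Sigma) : Prop :=
  exists p q, [/\ p \in tinit t, q \in tfinal t & tpath p x y q].

Definition tinv (Sigma : finType) (t : transducer Sigma) : transducer Sigma :=
  Transducer
    [seq (e.1.1.1, e.1.2, e.1.1.2, e.2) | e <- ttrans t] (tinit t) (tfinal t).

Lemma realizes_tinv (Sigma : finType) (t : transducer Sigma) x y :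
  realizes (tinv t) x y <-> realizes t y x.
Proof.
split=> -[p [q [pI qF pq]]]; exists p, q; split=> //.
- elim: pq => {p q x y pI qF} [p|p u v q x y r e _ IH]; first exact: tpath_nil.
  apply: tpath_cons IH; case/mapP: e => -[[[p' u'] v'] q'] e /=.
  by case=> -> -> -> ->.
- elim: pq => {p q x y pI qF} [p|p u v q x y r e _ IH].
    exact: (@tpath_nil _ (tinv t)).
  by apply: (@tpath_cons _ (tinv t) p v u q) IH; apply/mapP; exists (p, u, v, q).
Qed.

Definition image (Sigma : finType) (t : transducer Sigma)
    (X : set (seq Sigma)) : set (seq Sigma) :=
  [set y | exists2 x, X x & realizes t x y].

(* A strict total order on words for which every word has finitely many
   predecessors, so that its position is defined. *)
Definition word_order (Sigma : finType)
    (prec : seq Sigma -> seq Sigma -> Prop) : Prop :=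
  [/\ forall x, ~ prec x x,
      forall x y z, prec x y -> prec y z -> prec x z,
      forall x y, [\/ prec x y, x = y | prec y x]
    & forall w, finite_set [set v | prec v w]].

Definition input_decreasing (Sigma : finType)
    (prec : seq Sigma -> seq Sigma -> Prop) (t : transducer Sigma) : Prop :=
  forall x y, realizes t x y -> prec y x.

Definition independent (Sigma : finType) (t : transducer Sigma)
    (L : set (seq Sigma)) : Prop :=
  image t L `&` L = set0.

Definition maximal_independent (Sigma : finType) (t : transducer Sigma)
    (M L : set (seq Sigma)) : Prop :=
  [/\ L `<=` M, independent t L
    & forall w, (M `\` L) w -> ~ independent t (L `|` [set w])].

Definition indep_words (Sigma : finType) (t : transducer Sigma)
    (M X : set (seq Sigma)) : set (seq Sigma) :=
  M `\` (image t X `|` image (tinv t) X).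

Definition mu (Sigma : finType) (t : transducer Sigma)
    (M X : set (seq Sigma)) : set (seq Sigma) :=
  indep_words t M X `\` image (tinv t) (indep_words t M X).

Definition mu_iter (Sigma : finType) (t : transducer Sigma)
    (M : set (seq Sigma)) (i : nat) (X : set (seq Sigma)) : set (seq Sigma) :=
  iter i (mu t M) X.

Definition mu_star (Sigma : finType) (t : transducer Sigma)
    (M X : set (seq Sigma)) : set (seq Sigma) :=
  \bigcup_i mu_iter t M i X.

(* Main.v *)
Require Import Defs.
From mathcomp Require Import all_boot.
From mathcomp Require Import boolp classical_sets cardinality.

Set Implicit Arguments.
Unset Strict Implicit.
Unset Printing Implicit Defensive.

Local Open Scope classical_set_scope.

(** Every construction is carried out on lists and its computability is derived
    from closure properties of functions on [pickle] codes.  Difference of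
    regular languages is the product with a subset automaton; the image under a
    transducer is a product automaton with empty moves, removed by transitive
    closure.  These two operations express [mu].

    If [X] is independent then [X `<=` mu X] and [mu X] is independent, so a
    stable [mu_iter i L] is a fixed point [X] of [mu].  A word that can be added
    to [X] lies in [I(X)]; by induction on [prec], [I(X) `<=` X], because an
    image in [I(X)] of [w] would be smaller than [w], hence in [X], which
    excludes [w] from [I(X)]. *)

(** * Recursive functions on codes *)

(* [c x] is the list of arguments that encodes [x]; restricting [X] restricts
   the inputs on which termination is required. *)
Definition computes (X : Type) (c : X -> seq nat) (f : X -> nat) : Prop :=
  exists e, forall x, eval e (c x) (f x).

Section Computes.
Variables (X : Type) (c : X -> seq nat).

Lemma eq_computes (f g : X -> nat) : f =1 g -> computes c f -> computes c g.
Proof. by move=> fg [e ef]; exists e => x; rewrite -fg. Qed.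

Lemma computes_proj i (f : X -> nat) :
  (forall x, i < size (c x) /\ nth 0 (c x) i = f x) -> computes c f.
Proof. by move=> cf; exists (RProj i) => x; have [? <-] := cf x; constructor. Qed.

(** The intermediate value lives in a type [Y] with its own coding [d], so the outer program has to
    halt only on the codes of elements of [Y], not on every number. *)
Lemma computes_comp1 (Y : Type) (d : Y -> nat) (h : X -> Y) (g : Y -> nat) :
  computes (fun y => [:: d y]) g -> computes c (fun x => d (h x)) ->
  computes c (fun x => g (h x)).
Proof.
move=> [eg Hg] [ed Hd]; exists (RComp eg [:: ed]) => x.
by apply: (eval_comp (ys := [:: d (h x)])) => //; do !constructor.
Qed.

Lemma computes_comp2 (Y : Type) (d1 d2 : Y -> nat) (h : X -> Y)
    (g : Y -> nat) :
  computes (fun y => [:: d1 y; d2 y]) g ->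
  computes c (fun x => d1 (h x)) -> computes c (fun x => d2 (h x)) ->
  computes c (fun x => g (h x)).
Proof.
move=> [eg Hg] [e1 H1] [e2 H2]; exists (RComp eg [:: e1; e2]) => x.
by apply: (eval_comp (ys := [:: d1 (h x); d2 (h x)])) => //; do !constructor.
Qed.

Lemma computes_const n : computes c (fun=> n).
Proof.
elim: n => [|n [e He]]; first by exists RZero => x; constructor.
exists (RComp RSucc [:: e]) => x.
by apply: (eval_comp (ys := [:: n])); do !constructor.
Qed.

(** The accumulator passed to the step is always the true value [h z.1 z.2]; the step program may
    therefore rely on every property of the values actually reached. *)
Lemma computes_rec (h : nat -> X -> nat) :
  computes c (h 0) ->
  computes (fun z : nat * X => [:: z.1, h z.1 z.2 & c z.2])
           (fun z => h z.1.+1 z.2) ->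
  computes (fun z : nat * X => z.1 :: c z.2) (fun z => h z.1 z.2).
Proof.
move=> [e0 H0] [eS HS]; exists (RRec e0 eS) => -[n x] /=.
elim: n => [|n IH]; first by constructor.
by apply: eval_recS IH _; apply: (HS (n, x)).
Qed.

Lemma computes_min (n : X -> nat) (h : nat -> X -> nat) :
  computes (fun z : nat * X => z.1 :: c z.2) (fun z => h z.1 z.2) ->
  (forall x m, m < n x -> 0 < h m x) -> (forall x, h (n x) x = 0) ->
  computes c n.
Proof.
move=> [e He] h_gt0 h0; exists (RMin e) => x.
(* [eval_min] asks for the positive values in the form of a successor, hence the predecessor. *)
apply: (eval_min (v := fun m => (h m x).-1)); last first.
  by have:= He (n x, x); rewrite /= h0.
by move=> m /h_gt0 hm; have:= He (m, x); rewrite /= prednK.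
Qed.
End Computes.

Lemma computes_succ : computes (fun n => [:: n]) succn.
Proof. by exists RSucc => n; constructor. Qed.

Lemma computes_rec1 (h : nat -> nat) :
  computes (fun n => [:: n; h n]) (fun n => h n.+1) ->
  computes (fun n => [:: n]) h.
Proof.
(* Recursion over an empty parameter list, represented by [unit]; the base value [h 0] is then a
   constant. *)
move=> hS; have [||e He] := @computes_rec unit (fun=> [::]) (fun n _ => h n).
- exact: computes_const.
- by have [e He] := hS; exists e => -[n x]; apply: He.
by exists e => n; apply: (He (n, tt)).
Qed.

Lemma computes_pred : computes (fun n => [:: n]) predn.
Proof. by apply: computes_rec1; apply: (computes_proj (i := 0)). Qed.

Lemma computes_double : computes (fun n => [:: n]) double.
Proof.
apply: computes_rec1.
apply: (computes_comp1 (h := fun n => n.*2.+1) computes_succ).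
apply: (computes_comp1 (h := fun n => n.*2) computes_succ).
exact: (computes_proj (i := 1)).
Qed.

Lemma computes_iter (f : nat -> nat) : computes (fun n => [:: n]) f ->
  computes (fun z : nat * nat => [:: z.1; z.2]) (fun z => iter z.1 f z.2).
Proof.
move=> Hf.
apply: (computes_rec (h := fun n x => iter n f x) (c := fun x => [:: x])).
  exact: (computes_proj (i := 0)).
apply: (computes_comp1 (h := fun z : nat * nat => iter z.1 f z.2) Hf).
exact: (computes_proj (i := 1)).
Qed.

(** Subtraction iterates [predn]; the subtrahend comes first because recursion runs on the first
    argument. *)
Lemma computes_sub :
  computes (fun z : nat * nat => [:: z.1; z.2]) (fun z => z.2 - z.1).
Proof.
apply: eq_computes (computes_iter computes_pred) => -[n m] /=.
by elim: n => [|n IH]; rewrite ?subn0 //= IH subnS.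
Qed.

Lemma computes_odd : computes (fun n => [:: n]) odd.
Proof.
apply: computes_rec1.
apply: (@eq_computes _ _ (fun n => 1 - odd n)) => [n|];
  first by rewrite /=; case: odd.
apply: (computes_comp2 (h := fun n => (odd n : nat, 1)) computes_sub).
  exact: (computes_proj (i := 1)).
exact: computes_const.
Qed.

Lemma computes_half : computes (fun n => [:: n]) half.
Proof.
apply: computes_rec1.
(* The recursion equation used is that half of [n.+1], rounded down, equals [n - n./2]. *)
apply: (@eq_computes _ _ (fun n => n - n./2)) => [n|].
  by rewrite -{1}[n]odd_double_half -addnn addnA addnK -uphalf_half.
apply: (computes_comp2 (h := fun n => (n./2, n)) computes_sub).
  exact: (computes_proj (i := 1)).
exact: (computes_proj (i := 0)).
Qed.

(* [CodeSeq.code (m :: s) = cons_code m (CodeSeq.code s)], definitionally. *)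
Definition cons_code (m n : nat) : nat := 2 ^ m * n.*2.+1.

Lemma cons_code_gt0 m n : 0 < cons_code m n.
Proof. by rewrite muln_gt0 expn_gt0. Qed.

Lemma iter_double m n : iter m double n = 2 ^ m * n.
Proof. by elim: m => [|m IH]; rewrite ?mul1n //= IH -mul2n mulnA expnS. Qed.

Lemma iter_half_cons_code k m n : k <= m ->
  iter k half (cons_code m n) = cons_code (m - k) n.
Proof.
elim: k => [|k IH] km; first by rewrite subn0.
rewrite /= IH ?(ltnW km) // /cons_code.
by rewrite -(subnSK km) expnS -mulnA mul2n doubleK.
Qed.

Lemma odd_cons_code m n : odd (cons_code m n) = (m == 0).
Proof. by rewrite oddM oddX /= odd_double andbT; case: m. Qed.

Lemma computes_cons_code :
  computes (fun z : nat * nat => [:: z.1; z.2]) (fun z => cons_code z.1 z.2).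
Proof.
apply: (@eq_computes _ _ (fun z => iter z.1 double z.2.*2.+1)) => [z|].
  exact: iter_double.
apply: (computes_comp2 (h := fun z : nat * nat => (z.1, z.2.*2.+1))
  (computes_iter computes_double)).
  exact: (computes_proj (i := 0)).
apply: (computes_comp1 (h := fun z : nat * nat => z.2.*2) computes_succ).
apply: (computes_comp1 (h := fun z : nat * nat => z.2) computes_double).
exact: (computes_proj (i := 1)).
Qed.

(** The head is the 2-adic valuation of the code, found as the least number of halvings that gives
    an odd number. On the code 0 of the empty list this search would diverge, so the inputs are
    restricted to values of [cons_code]. *)
Lemma computes_head_code :
  computes (fun z : nat * nat => [:: cons_code z.1 z.2]) (fun z => z.1).
Proof.
apply: (computes_min (h := fun k z =>
  1 - odd (iter k half (cons_code z.1 z.2)))) => [|x m|x]; last first.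
- by rewrite iter_half_cons_code // subnn odd_cons_code.
- move=> mx; rewrite iter_half_cons_code ?(ltnW mx) // odd_cons_code.
  by move: mx; rewrite -subn_gt0; case: (x.1 - m).
pose u (z : nat * (nat * nat)) := iter z.1 half (cons_code z.2.1 z.2.2).
apply: (computes_comp2 (h := fun z => (odd (u z) : nat, 1)) computes_sub).
  apply: (computes_comp1 (h := u) computes_odd).
  apply: (computes_comp2 (h := fun z => (z.1, cons_code z.2.1 z.2.2))
    (computes_iter computes_half)).
    exact: (computes_proj (i := 0)).
  exact: (computes_proj (i := 1)).
exact: computes_const.
Qed.

(** After as many halvings as the head indicates, the code has become [z.2.*2.+1]; one more halving
    gives the tail. *)
Lemma computes_behead_code :
  computes (fun z : nat * nat => [:: cons_code z.1 z.2]) (fun z => z.2).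
Proof.
apply: (@eq_computes _ _ (fun z => iter z.1.+1 half (cons_code z.1 z.2))) => [z|].
  by rewrite /= iter_half_cons_code // subnn /cons_code mul1n /= uphalf_double.
apply: (computes_comp2 (h := fun z => (z.1.+1, cons_code z.1 z.2))
  (computes_iter computes_half)).
  exact: (computes_comp1 (h := fun z : nat * nat => z.1)
    computes_succ computes_head_code).
exact: (computes_proj (i := 0)).
Qed.

(** A conditional by recursion on the truth value: [f] is the base case and [g] the step. The base
    is evaluated in both cases, whereas [g] is run only where [b] holds, which allows [g] to diverge
    elsewhere. *)
Lemma computes_case (X : Type) (p : X -> nat) (b : pred X) (f g : X -> nat) :
  computes (fun x => [:: p x]) b -> computes (fun x => [:: p x]) f ->
  computes (fun y : {x | b x} => [:: p (sval y)]) (fun y => g (sval y)) ->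
  computes (fun x => [:: p x]) (fun x => if b x then g x else f x).
Proof.
move=> [eb Hb] [ef Hf] [eg Hg].
(* The step receives the counter, the previous value and [p x]; [RProj 2] keeps only the last. *)
exists (RComp (RRec ef (RComp eg [:: RProj 2])) [:: eb; RProj 0]) => x.
apply: (eval_comp (ys := [:: b x : nat; p x])).
  by apply: evals_cons => //; apply: evals_cons; constructor.
case: ifP => bx; last by constructor.
apply: eval_recS; first by constructor.
apply: (eval_comp (ys := [:: p x])); first by do !constructor.
exact: (Hg (exist _ x bx)).
Qed.

(** * Computable functions between countable types *)

Definition computable (aT bT : countType) (f : aT -> bT) : Prop :=
  computes (fun x => [:: pickle x]) (fun x => pickle (f x)).

Lemma eq_computable (aT bT : countType) (f g : aT -> bT) :
  f =1 g -> computable f -> computable g.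
Proof. by move=> fg; apply: eq_computes => x; rewrite fg. Qed.

Lemma computable_comp (aT bT cT : countType) (g : bT -> cT) (f : aT -> bT) :
  computable g -> computable f -> computable (fun x => g (f x)).
Proof. exact: (computes_comp1 (h := f)). Qed.

Lemma computable_id (T : countType) : computable (@id T).
Proof. exact: (computes_proj (i := 0)). Qed.

Lemma pickle_bool (b : bool) : pickle b = b.
Proof. by case: b. Qed.

(** A pair has the code of the two-element list of its codes; the final 0 is the empty list. *)
Lemma computes_pair (bT cT : countType) (X : Type) (c : X -> seq nat)
    (f : X -> bT) (g : X -> cT) :
  computes c (fun x => pickle (f x)) -> computes c (fun x => pickle (g x)) ->
  computes c (fun x => pickle (f x, g x)).
Proof.
move=> Hf Hg.
apply: (computes_comp2 (h := fun x => (pickle (f x), cons_code (pickle (g x)) 0))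
  computes_cons_code) => //.
apply: (computes_comp2 (h := fun x => (pickle (g x), 0)) computes_cons_code) => //.
exact: computes_const.
Qed.

Section Operations.
Variables aT bT cT : countType.

Lemma computable_const (b : bT) : computable (fun _ : aT => b).
Proof. exact: computes_const. Qed.

Lemma computable_pair (f : aT -> bT) (g : aT -> cT) :
  computable f -> computable g -> computable (fun x => (f x, g x)).
Proof. exact: computes_pair. Qed.

Lemma computes_head (X : Type) (c : X -> seq nat) (m n : X -> nat) :
  computes c (fun x => cons_code (m x) (n x)) -> computes c m.
Proof. exact: (computes_comp1 (h := fun x => (m x, n x)) computes_head_code). Qed.

Lemma computes_behead (X : Type) (c : X -> seq nat) (m n : X -> nat) :
  computes c (fun x => cons_code (m x) (n x)) -> computes c n.
Proof.
exact: (computes_comp1 (h := fun x => (m x, n x)) computes_behead_code).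
Qed.

Lemma pickle_pair (b : bT) (c : cT) :
  pickle (b, c) = cons_code (pickle b) (cons_code (pickle c) 0).
Proof. by []. Qed.

Lemma computable_fst (f : aT -> bT * cT) :
  computable f -> computable (fun x => (f x).1).
Proof.
move=> Hf; apply: (computes_head (n := fun x => cons_code (pickle (f x).2) 0)).
by apply: eq_computes Hf => x; rewrite -pickle_pair; case: (f x).
Qed.

Lemma computable_snd (f : aT -> bT * cT) :
  computable f -> computable (fun x => (f x).2).
Proof.
move=> Hf; apply: (computes_head (n := fun=> 0)).
apply: (computes_behead (m := fun x => pickle (f x).1)).
by apply: eq_computes Hf => x; rewrite -pickle_pair; case: (f x).
Qed.

Lemma computable_cons (f : aT -> bT) (s : aT -> seq bT) :
  computable f -> computable s -> computable (fun x => f x :: s x).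
Proof.
exact: (computes_comp2 (h := fun x => (pickle (f x), pickle (s x)))
  computes_cons_code).
Qed.

Lemma computable_pickle (f : aT -> bT) :
  computable f -> computable (fun x => pickle (f x)).
Proof. by []. Qed.

Lemma computable_if (b : pred aT) (f g : aT -> bT) :
  computable b -> computable f -> computable g ->
  computable (fun x => if b x then f x else g x).
Proof.
move=> Hb Hf Hg.
apply: (@eq_computes _ _ (fun x => if b x then pickle (f x) else pickle (g x)))
  => [x|]; first by case: (b x).
apply: computes_case Hg _.
  by apply: eq_computes Hb => x; rewrite pickle_bool.
by have [e He] := Hf; exists e => -[x bx]; apply: He.
Qed.

(** Codes of nonempty lists are positive, so a sign test selects the branch; decoding of head and
    tail happens only in the branch where it terminates. *)
Lemma computable_seq_case (s : aT -> seq bT) (f : aT -> cT)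
    (g : aT -> bT -> seq bT -> cT) :
  computable s -> computable f ->
  computable (fun z : aT * (bT * seq bT) => g z.1 z.2.1 z.2.2) ->
  computable (fun x => if s x is b :: s' then g x b s' else f x).
Proof.
move=> Hs Hf Hg; pose b0 := fun x => s x != [::].
pose gs x := if s x is b :: s' then pickle (g x b s') else 0.
apply: (@eq_computes _ _ (fun x => if b0 x then gs x else pickle (f x)))
  => [x|]; first by rewrite /b0 /gs; case: (s x).
apply: computes_case Hf _.
  (* Double truncated subtraction from 1 is the sign of the code. *)
  apply: (@eq_computes _ _ (fun x => 1 - (1 - pickle (s x)))) => [x|].
    rewrite /b0; case: (s x) => //= b s'.
    by rewrite -[pickle (b :: s')]prednK // (cons_code_gt0 (pickle b) (pickle s')).
  apply: (computes_comp2 (h := fun x => (1 - pickle (s x), 1)) computes_sub);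
    last exact: computes_const.
  by apply: (computes_comp2 (h := fun x => (pickle (s x), 1)) computes_sub);
    last exact: computes_const.
(* An element of [Z] carries the head and the tail as data, so that the code of [s] is a value of
   [cons_code] on all of [Z]. *)
pose Z := {z : aT * (bT * seq bT) | s z.1 = z.2.1 :: z.2.2}.
have [e He] : computes (fun z : Z => [:: pickle (sval z).1])
                       (fun z => pickle (g (sval z).1 (sval z).2.1 (sval z).2.2)).
  apply: (computes_comp1 (h := fun z : Z => sval z) Hg).
  have Hsz : computes (fun z : Z => [:: pickle (sval z).1])
      (fun z => cons_code (pickle (sval z).2.1) (pickle (sval z).2.2)).
    have [e He] := Hs; exists e => -[z sz].
    by have:= He z.1; rewrite /= sz.
  apply: (@computes_pair _ _ Z _ (fun z => (sval z).1) (fun z => (sval z).2)).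
    exact: (computes_proj (i := 0)).
  apply: (@eq_computes _ _ (fun z : Z => pickle ((sval z).2.1, (sval z).2.2))).
    by move=> -[[x []]].
  apply: computes_pair; first exact: computes_head Hsz.
  exact: computes_behead Hsz.
exists e => -[x /=]; rewrite /b0 /gs; case sx: (s x) => [|b s'] // _.
exact: (He (exist _ (x, (b, s')) sx)).
Qed.

Lemma computable_iter (n : aT -> nat) (f : aT -> bT -> bT) (b : aT -> bT) :
  computable n -> computable (fun z : aT * bT => f z.1 z.2) -> computable b ->
  computable (fun x => iter (n x) (f x) (b x)).
Proof.
move=> Hn Hf Hb.
have Hrec : computes (fun z : nat * aT => [:: z.1; pickle z.2])
                     (fun z => pickle (iter z.1 (f z.2) (b z.2))).
  apply: (computes_rec (h := fun n x => pickle (iter n (f x) (b x)))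
    (c := fun x => [:: pickle x])) => //=.
  apply: (computes_comp1 (h := fun z : nat * aT => (z.2, iter z.1 (f z.2) (b z.2)))
    Hf).
  apply: (@computes_pair _ _ _ _ snd (fun z => iter z.1 (f z.2) (b z.2))).
    exact: (computes_proj (i := 2)).
  exact: (computes_proj (i := 1)).
apply: (computes_comp2 (h := fun x => (n x, x)) Hrec) => //.
exact: computable_id.
Qed.

(** [pickle] is injective, so codes are compared: both truncated differences vanish exactly when the
    codes agree. *)
Lemma computable_eq (f g : aT -> bT) :
  computable f -> computable g -> computable (fun x => f x == g x).
Proof.
move=> Hf Hg; pose m x := pickle (f x); pose n x := pickle (g x).
apply: (@eq_computes _ _ (fun x => 1 - (m x - n x) - (n x - m x))) => [x|].
  rewrite pickle_bool -(inj_eq (pcan_inj pickleK)) -/(m x) -/(n x).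
  case: ltngtP => [mn|mn|->]; last by rewrite subnn.
  - by apply/eqP; rewrite subn_eq0 (leq_trans (leq_subr _ _)) ?subn_gt0.
  - by apply/eqP; rewrite -subnDA subn_eq0 ltn_addr ?subn_gt0.
apply: (computes_comp2 (h := fun x => (n x - m x, 1 - (m x - n x))) computes_sub).
  by apply: (computes_comp2 (h := fun x => (m x, n x)) computes_sub).
apply: (computes_comp2 (h := fun x => (m x - n x, 1)) computes_sub);
  last exact: computes_const.
by apply: (computes_comp2 (h := fun x => (n x, m x)) computes_sub).
Qed.
End Operations.

(** This makes the code of a list a computable bound on the number of steps of a loop over it. *)
Lemma leq_size_pickle (T : countType) (s : seq T) : size s <= pickle s.
Proof.
elim: s => // a s IH; rewrite [pickle _]/(cons_code (pickle a) (pickle s)) /=.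
rewrite -[(size s).+1]mul1n leq_mul ?expn_gt0 // ltnS -addnn.
by rewrite (leq_trans IH) ?leq_addr.
Qed.

(** * Folds and operations on lists *)

Section Sequences.
Variables cT aT bT : countType.

Let step (f : cT -> bT -> aT -> bT) (c : cT) (z : seq aT * bT) : seq aT * bT :=
  if z.1 is a :: s then (s, f c z.2 a) else z.

(** The loop [step] is run [pickle (s c)] times, which is at least the length of the list; once the
    list is exhausted, [step] leaves the state unchanged, so the surplus rounds are harmless. *)
Lemma computable_foldl (f : cT -> bT -> aT -> bT) (b : cT -> bT)
    (s : cT -> seq aT) :
  computable (fun z : cT * (bT * aT) => f z.1 z.2.1 z.2.2) -> computable b ->
  computable s -> computable (fun c => foldl (f c) (b c) (s c)).
Proof.
move=> Hf Hb Hs.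
apply: (@eq_computable _ _
  (fun c => (iter (pickle (s c)) (step f c) (s c, b c)).2)) => [c|].
  move: (pickle _) (leq_size_pickle (s c)) (b c) => n.
  elim: (s c) n => [|a s' IH] [|n] //= les d; last by rewrite -iterS iterSr IH.
  by rewrite (_ : step f c (iter n (step f c) ([::], d)) = ([::], d)) // -iterS;
    elim: n.+1 => //= k ->.
apply: computable_snd; apply: computable_iter.
- exact: computable_pickle.
- apply: computable_seq_case.
  + by apply/computable_fst/computable_snd/computable_id.
  + exact/computable_snd/computable_id.
  + apply: computable_pair.
      by do 2!apply: computable_snd; apply: computable_id.
    apply: (computable_comp
      (f := fun z : (cT * (seq aT * bT)) * (aT * seq aT) =>
              (z.1.1, (z.1.2.2, z.2.1))) Hf).
    apply: computable_pair.
      exact/computable_fst/computable_fst/computable_id.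
    apply: computable_pair.
      exact/computable_snd/computable_snd/computable_fst/computable_id.
    exact/computable_fst/computable_snd/computable_id.
- exact: computable_pair.
Qed.
End Sequences.

Section MoreSequences.
Variables cT aT bT : countType.
Implicit Types s : cT -> seq aT.

Lemma computable_rev s : computable s -> computable (fun c => rev (s c)).
Proof.
move=> Hs; apply: (@eq_computable _ _
    (fun c => foldl (fun t a => a :: t) [::] (s c))) => [c|].
  by rewrite -{1}[s c]revK foldl_rev; elim: (rev (s c)) => //= a t ->.
apply: computable_foldl => //; last exact: computable_const.
apply: computable_cons; first exact/computable_snd/computable_snd/computable_id.
exact/computable_fst/computable_snd/computable_id.
Qed.

Lemma computable_foldr (f : cT -> aT -> bT -> bT) (b : cT -> bT) s :
  computable (fun z : cT * (aT * bT) => f z.1 z.2.1 z.2.2) -> computable b ->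
  computable s -> computable (fun c => foldr (f c) (b c) (s c)).
Proof.
move=> Hf Hb Hs; apply: (@eq_computable _ _
    (fun c => foldl (fun d a => f c a d) (b c) (rev (s c)))) => [c|].
  exact: foldl_rev.
apply: computable_foldl => //; last exact: computable_rev.
apply: (computable_comp (f := fun z : cT * (bT * aT) => (z.1, (z.2.2, z.2.1))) Hf).
apply: computable_pair; first exact/computable_fst/computable_id.
apply: computable_pair; first exact/computable_snd/computable_snd/computable_id.
exact/computable_fst/computable_snd/computable_id.
Qed.

End MoreSequences.

Lemma computable_cat (cT aT : countType) (s1 s2 : cT -> seq aT) :
  computable s1 -> computable s2 -> computable (fun c => s1 c ++ s2 c).
Proof.
move=> H1 H2; apply: (@eq_computable _ _ (fun c => foldr cons (s2 c) (s1 c))).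
  by move=> c; elim: (s1 c) => //= a t ->.
apply: computable_foldr => //; apply: computable_cons.
  exact/computable_fst/computable_snd/computable_id.
exact/computable_snd/computable_snd/computable_id.
Qed.

Lemma computable_flatten_map (cT aT bT : countType)
    (f : cT -> aT -> seq bT) (s : cT -> seq aT) :
  computable (fun z : cT * aT => f z.1 z.2) -> computable s ->
  computable (fun c => flatten (map (f c) (s c))).
Proof.
move=> Hf Hs; apply: (@eq_computable _ _
  (fun c => foldr (fun a t => f c a ++ t) [::] (s c))).
  by move=> c; elim: (s c) => //= a t ->.
apply: computable_foldr => //; last exact: computable_const.
apply: computable_cat; last exact/computable_snd/computable_snd/computable_id.
apply: (computable_comp (f := fun z : cT * (aT * seq bT) => (z.1, z.2.1)) Hf).
apply: computable_pair; first exact/computable_fst/computable_id.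
exact/computable_fst/computable_snd/computable_id.
Qed.

Lemma computable_map (cT aT bT : countType) (f : cT -> aT -> bT)
    (s : cT -> seq aT) :
  computable (fun z : cT * aT => f z.1 z.2) -> computable s ->
  computable (fun c => map (f c) (s c)).
Proof.
move=> Hf Hs; apply: (@eq_computable _ _
  (fun c => flatten (map (fun a => [:: f c a]) (s c)))).
  by move=> c; elim: (s c) => //= a t ->.
apply: computable_flatten_map => //; apply: computable_cons => //.
exact: computable_const.
Qed.

Lemma computable_filter (cT aT : countType) (p : cT -> pred aT)
    (s : cT -> seq aT) :
  computable (fun z : cT * aT => p z.1 z.2) -> computable s ->
  computable (fun c => filter (p c) (s c)).
Proof.
move=> Hp Hs; apply: (@eq_computable _ _
  (fun c => flatten (map (fun a => if p c a then [:: a] else [::]) (s c)))).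
  by move=> c; elim: (s c) => //= a t ->; case: (p c a).
apply: computable_flatten_map => //; apply: computable_if => //.
  apply: computable_cons; first exact/computable_snd/computable_id.
  exact: computable_const.
exact: computable_const.
Qed.

Lemma computable_has (cT aT : countType) (p : cT -> pred aT)
    (s : cT -> seq aT) :
  computable (fun z : cT * aT => p z.1 z.2) -> computable s ->
  computable (fun c => has (p c) (s c)).
Proof.
move=> Hp Hs; apply: (@eq_computable _ _
  (fun c => foldr (fun a d => if p c a then true else d) false (s c))).
  by move=> c; elim: (s c) => //= a t ->; case: (p c a).
apply: computable_foldr => //; last exact: computable_const.
apply: computable_if; first apply: (computable_comp
  (f := fun z : cT * (aT * bool) => (z.1, z.2.1)) Hp).
- apply: computable_pair; first exact/computable_fst/computable_id.
  exact/computable_fst/computable_snd/computable_id.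
- exact: computable_const.
- exact/computable_snd/computable_snd/computable_id.
Qed.

Lemma computable_mem (cT aT : countType) (f : cT -> aT) (s : cT -> seq aT) :
  computable f -> computable s -> computable (fun c => f c \in s c).
Proof.
move=> Hf Hs; apply: (@eq_computable _ _ (fun c => has (pred1 (f c)) (s c))).
  by move=> c; rewrite has_pred1.
apply: computable_has => //; apply: computable_eq.
  exact/computable_snd/computable_id.
exact/(computable_comp Hf)/computable_fst/computable_id.
Qed.

Lemma computable_not (cT : countType) (p : pred cT) :
  computable p -> computable (fun c => ~~ p c).
Proof. by move=> Hp; apply: computable_if => //; apply: computable_const. Qed.

(* Dispatching on the syntactic form of the body matters: up to conversion
   every function into [nat] is an instance of [computable_pickle]. *)
Ltac computable_step := cbn beta; lazymatch goal with
  | |- computable (fun=> ?c) => exact: computable_const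
  | |- computable (fun x => x) => exact: computable_id
  | |- computable (fun x => fst _) => apply: computable_fst
  | |- computable (fun x => snd _) => apply: computable_snd
  | |- computable (fun x => pair _ _) => apply: computable_pair
  | |- computable (fun x => pickle _) => apply: computable_pickle
  | |- computable (fun x => cat _ _) => apply: computable_cat
  | |- computable (fun x => cons _ _) => apply: computable_cons
  | |- computable (fun x => flatten _) => apply: computable_flatten_map
  | |- computable (fun x => map _ _) => apply: computable_map
  | |- computable (fun x => filter _ _) => apply: computable_filter
  | |- computable (fun x => has _ _) => apply: computable_has
  | |- computable (fun x => foldr _ _ _) => apply: computable_foldr
  | |- computable (fun x => ~~ _) => apply: computable_not
  | |- computable (fun x => _ == _) => apply: computable_eq
  | |- computable (fun x => _ \in _) => apply: computable_mem
  | H : computable ?f |- computable (fun x => ?f _) =>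
      apply: (computable_comp H)
  | |- computable (fun x => _) => fail
  | |- computable ?f => change (computable (fun x => f x))
  end.
Ltac prove_computable := repeat computable_step.

Definition sublists (T : Type) (s : seq T) : seq (seq T) :=
  foldr (fun x l => l ++ [seq x :: u | u <- l]) [:: [::]] s.

(** The state sets of the subset automaton are all filters of one fixed list, so each has a
    canonical representative here and no identification up to permutation arises. *)
Lemma filter_in_sublists (T : eqType) (p : pred T) (s : seq T) :
  filter p s \in sublists s.
Proof.
elim: s => //= x s IH; rewrite mem_cat.
by case: (p x); rewrite ?IH // (map_f (cons x)) ?orbT.
Qed.

Lemma computable_sublists (cT aT : countType) (s : cT -> seq aT) :
  computable s -> computable (fun c => sublists (s c)).
Proof. by move=> Hs; rewrite /sublists; prove_computable. Qed.

(** * Automata as inputs and outputs of computable functions *)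

Section NfaComputable.
Variables (cT : countType) (Sigma : finType).

(** The code of an automaton is, by conversion, the code of the triple of its lists. *)
Lemma computable_NFA (T : cT -> seq (nat * Sigma * nat)) (I F : cT -> seq nat) :
  computable T -> computable I -> computable F ->
  computable (fun c => NFA (T c) (I c) (F c)).
Proof.
move=> HT HI HF.
by have : computable (fun c => (T c, I c, F c)) by prove_computable.
Qed.

Variable A : cT -> nfa Sigma.
Hypothesis A_computable : computable A.

Let tuple_computable : computable (fun c => nfa_tuple (A c)).
Proof. exact: A_computable. Qed.

Lemma computable_nfa_trans : computable (fun c => nfa_trans (A c)).
Proof.
by apply: (computable_fst (f := fun c => (nfa_tuple (A c)).1)); prove_computable.
Qed.

Lemma computable_nfa_init : computable (fun c => nfa_init (A c)).
Proof.
by apply: (computable_snd (f := fun c => (nfa_tuple (A c)).1)); prove_computable.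
Qed.

Lemma computable_nfa_final : computable (fun c => nfa_final (A c)).
Proof. exact: computable_snd tuple_computable. Qed.
End NfaComputable.

Ltac prove_nfa_computable := repeat first [ computable_step
  | lazymatch goal with
    | |- computable (fun x => sublists _) => apply: computable_sublists
    | |- computable (fun x => NFA _ _ _) => apply: computable_NFA
    | |- computable (fun x => nfa_trans _) => apply: computable_nfa_trans
    | |- computable (fun x => nfa_init _) => apply: computable_nfa_init
    | |- computable (fun x => nfa_final _) => apply: computable_nfa_final
    end ].

(** * Difference of regular languages *)

Section Automata.
Variable Sigma : finType.
Implicit Types A B : nfa Sigma.

(** A source that is neither initial nor a target is never reached, so this list contains every
    state visited by a run from an initial state. *)
Definition nfa_states A : seq nat :=
  nfa_init A ++ [seq e.2 | e <- nfa_trans A].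

Lemma nfa_states_trans A p a q : (p, a, q) \in nfa_trans A -> q \in nfa_states A.
Proof. by move=> e; rewrite mem_cat (map_f snd e) orbT. Qed.

Lemma nfa_path_cat A p u v r :
  nfa_path A p (u ++ v) r <-> exists2 q, nfa_path A p u q & nfa_path A q v r.
Proof.
elim: u p => [|a u IH] p /=.
  by split=> [?|[q ->]] //; exists p.
split=> [[s e /IH[q uq vq]]|[q [s e uq] vq]].
  by exists q => //; exists s.
by exists s => //; apply/IH; exists q.
Qed.

Lemma nfa_path_states A p w q :
  p \in nfa_states A -> nfa_path A p w q -> q \in nfa_states A.
Proof.
elim: w p => [|a w IH] p /=; first by move=> + <-.
by move=> _ [r /nfa_states_trans/IH].
Qed.

Definition subset_step B (T : seq nat) (a : Sigma) : seq nat :=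
  [seq x <- nfa_states B | has (fun p => (p, a, x) \in nfa_trans B) T].

Lemma mem_subset_step B T w q :
  q \in foldl (subset_step B) T w <-> exists2 p, p \in T & nfa_path B p w q.
Proof.
elim: w T => [|a w IH] T /=.
  by split=> [|[p pT <-]] //; exists q.
rewrite IH; split=> [[r]|[p pT [r e rq]]].
  by rewrite mem_filter => /andP[/hasP[p pT e] _] rq; exists p => //; exists r.
exists r => //; rewrite mem_filter (nfa_states_trans e) andbT.
by apply/hasP; exists p.
Qed.

(** The second component of a state is the set of all states that [B] can have reached, so a word is
    rejected by [B] when this set has no final state. Pairs are numbered by [pickle] because states
    are natural numbers. *)
Definition nfa_diff A B : nfa Sigma := NFA
  [seq (pickle (e.1.1, T), e.1.2, pickle (e.2, subset_step B T e.1.2))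
    | e <- nfa_trans A, T <- sublists (nfa_states B)]
  [seq pickle (p, [seq x <- nfa_states B | x \in nfa_init B])
    | p <- nfa_init A]
  [seq pickle (q, T) | q <- nfa_final A,
    T <- [seq T <- sublists (nfa_states B)
           | ~~ has (fun x => x \in nfa_final B) T]].

Lemma nfa_diff_path A B p T w s : T \in sublists (nfa_states B) ->
  nfa_path (nfa_diff A B) (pickle (p, T)) w s <->
  exists2 q, nfa_path A p w q & s = pickle (q, foldl (subset_step B) T w).
Proof.
elim: w p T s => [|a w IH] p T s Tsub /=.
  by split=> [<-|[q <-]] //; exists p.
have stepP b := filter_in_sublists
  (fun x => has (fun p => (p, b, x) \in nfa_trans B) T) (nfa_states B).
split=> [[r /allpairsP[[[[p' b] q'] T'] /= [e T's [/(pcan_inj pickleK) eqp -> ->]]]]|].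
  case: eqp e T's => <- <- e _ /(IH _ _ _ (stepP _))[q q'q ->].
  by exists q => //; exists q'.
move=> [q [r e rq] ->]; exists (pickle (r, subset_step B T a)).
  by apply/allpairsP; exists (p, a, r, T).
by apply/(IH _ _ _ (stepP _)); exists q.
Qed.

Lemma lang_nfa_diff A B : lang (nfa_diff A B) = lang A `\` lang B.
Proof.
apply/seteqP; split=> w /=.
  move=> [p [q [/mapP[i iA ->] /allpairsP[[f T] /= [fF + ->]]]]].
  rewrite mem_filter => /andP[/hasPn Tn Ts].
  move=> /(nfa_diff_path _ _ _ _ (filter_in_sublists _ _))[q' iq'].
  move=> /(pcan_inj pickleK)[eqf eqT]; subst q' T.
  split; first by exists i, f.
  move=> [p' [q' [p'I q'F p'q']]]; suff /Tn/negP[] : q' \in foldl (subset_step B)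
    [seq x <- nfa_states B | x \in nfa_init B] w by [].
  apply/mem_subset_step; exists p' => //.
  by rewrite mem_filter p'I mem_cat p'I.
move=> [[p [q [pI qF pq]]] nB].
set T0 := [seq x <- nfa_states B | x \in nfa_init B].
exists (pickle (p, T0)), (pickle (q, foldl (subset_step B) T0 w)).
split; first exact: (map_f (fun p => pickle (p, T0))).
  apply/allpairsP; exists (q, foldl (subset_step B) T0 w); split => //=.
  rewrite mem_filter; apply/andP; split.
    apply/hasPn => x /mem_subset_step[p']; rewrite mem_filter => /andP[p'I _] p'x.
    by apply/negP => xF; apply: nB; exists p', x.
  (* The set reached is a filter of [nfa_states B] in both cases: [T0] for the empty word, the
     result of the last [subset_step] otherwise. *)
  by case/lastP: w {pq nB} => [|w a]; rewrite ?foldl_rcons; apply: filter_in_sublists.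
by apply/(nfa_diff_path _ _ _ _ (filter_in_sublists _ _)); exists q.
Qed.

Lemma computable_nfa_diff (cT : countType) (A B : cT -> nfa Sigma) :
  computable A -> computable B -> computable (fun c => nfa_diff (A c) (B c)).
Proof.
move=> HA HB.
rewrite /nfa_diff /subset_step /nfa_states.
prove_nfa_computable.
Qed.
End Automata.

(** * Elimination of empty moves *)

(* Warshall's algorithm: [bypass E ks] adds to [E] the pairs joined through
   intermediate points in [ks]. *)
Definition bypass (E : seq (nat * nat)) (ks : seq nat) : seq (nat * nat) :=
  foldr (fun k R => R ++ [seq (x.1, y.2) |
    x <- [seq x <- R | x.2 == k], y <- [seq y <- R | y.1 == k]]) E ks.

Lemma mem_bypass_cons E k ks x y :
  (x, y) \in bypass E (k :: ks) <->
  (x, y) \in bypass E ks \/ (x, k) \in bypass E ks /\ (k, y) \in bypass E ks.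
Proof.
rewrite /= -/(bypass E ks) mem_cat.
split=> [/orP[|/allpairsP[[[a b] [c d]] /=]]|[->|[xk ky]]] //; first by left.
  by rewrite !mem_filter /= => -[/andP[/eqP-> +] /andP[/eqP-> +] [-> ->]]; right.
apply/orP; right; apply/allpairsP; exists ((x, k), (k, y)).
by rewrite !mem_filter /= !eqxx.
Qed.

(** Induction on [ks]: if one of the two pairs is joined through [k], so is the composite, and when
    both are, the part between the two visits of [k] is cut out. *)
Lemma bypass_trans E ks x y z : y \in ks ->
  (x, y) \in bypass E ks -> (y, z) \in bypass E ks -> (x, z) \in bypass E ks.
Proof.
elim: ks x y z => // k ks IH x y z; rewrite inE => /orP[/eqP->|yks].
  by rewrite !mem_bypass_cons => -[?|[? ?]] [?|[? ?]]; right.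
rewrite !mem_bypass_cons => -[xy|[xk ky]] [yz|[yk kz]].
- by left; apply: IH yz.
- by right; split=> //; apply: IH yk.
- by right; split=> //; apply: IH yz.
- by right.
Qed.

Lemma sub_bypass E ks : {subset E <= bypass E ks}.
Proof.
by move=> [x y] xy; elim: ks => // k ks IH; apply/mem_bypass_cons; left.
Qed.

Lemma bypass_source E ks x y : (x, y) \in bypass E ks -> x \in unzip1 E.
Proof.
elim: ks y => [|k ks IH] y; first by move/(map_f fst).
by case/mem_bypass_cons => [/IH|[/IH]].
Qed.

(** Only a source of [E] can be an intermediate point, so processing [unzip1 E] already gives the
    transitive closure. *)
Definition closure (E : seq (nat * nat)) : seq (nat * nat) :=
  bypass E (unzip1 E).

Lemma closure_trans E x y z :
  (x, y) \in closure E -> (y, z) \in closure E -> (x, z) \in closure E.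
Proof. by move=> xy yz; apply: bypass_trans (bypass_source yz) xy yz. Qed.

Section EmptyMoves.
Variables (Sigma : finType) (E : seq (nat * nat)) (O : seq (nat * Sigma * nat)).
Variables (I F : seq nat).

Inductive move_path : nat -> seq Sigma -> nat -> Prop :=
| move_path_nil p : move_path p [::] p
| move_path_empty p q w r : (p, q) \in E -> move_path q w r -> move_path p w r
| move_path_letter p a q w r :
    (p, a, q) \in O -> move_path q w r -> move_path p (a :: w) r.

Lemma move_path_cat p u q v r :
  move_path p u q -> move_path q v r -> move_path p (u ++ v) r.
Proof.
elim=> // {p u q} [p q u s e _ IH|p a q u s e _ IH] vr.
  exact: move_path_empty e (IH vr).
exact: move_path_letter e (IH vr).
Qed.

Lemma closure_move_path x y : (x, y) \in closure E -> move_path x [::] y.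
Proof.
rewrite /closure; elim: (unzip1 E) x y => [|k ks IH] x y.
  by move=> e; apply: move_path_empty e (move_path_nil _).
by case/mem_bypass_cons=> [/IH//|[/IH xk /IH]]; apply: (move_path_cat xk).
Qed.

(** Empty moves are absorbed into the next letter or, at the end of the word, into acceptance. The
    closure need not be reflexive, so [O] and [F] themselves are kept. *)
Definition elim_empty : nfa Sigma := NFA
  (O ++ [seq (x.1, o.1.2, o.2) | x <- closure E, o <- [seq o <- O | x.2 == o.1.1]])
  I (F ++ [seq x.1 | x <- [seq x <- closure E | x.2 \in F]]).

Lemma elim_empty_transP x a z :
  (x, a, z) \in nfa_trans elim_empty <->
  (x, a, z) \in O \/ exists2 y, (x, y) \in closure E & (y, a, z) \in O.
Proof.
rewrite mem_cat; split=> [/orP[|/allpairsPdep]|[->|[y xy yz]]] //; first by left.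
  move=> [[x' y] [[[y' a'] z'] [xy]]]; rewrite mem_filter /=.
  by move=> /andP[/eqP<- yz] [-> -> ->]; right; exists y.
apply/orP; right; apply/allpairsPdep; exists (x, y), (y, a, z).
by rewrite mem_filter eqxx.
Qed.

Lemma elim_empty_finalP x :
  x \in nfa_final elim_empty <->
  x \in F \/ exists2 y, (x, y) \in closure E & y \in F.
Proof.
rewrite mem_cat; split=> [/orP[|/mapP[[x' y]]]|[->|[y xy yF]]] //; first by left.
  by rewrite mem_filter /= => /andP[yF xy] ->; right; exists y.
by apply/orP; right; apply/mapP; exists (x, y); rewrite ?mem_filter ?yF.
Qed.

Lemma lang_elim_empty w :
  lang elim_empty w <-> exists p q, [/\ p \in I, q \in F & move_path p w q].
Proof.
split=> [[p [q [pI]]]|[p [q [pI qF pq]]]].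
  move=> /elim_empty_finalP qF pq.
  suff [f fF pf] : exists2 f, f \in F & move_path p w f by exists p, f.
  elim: w p {pI} pq => [|a w IH] p /= => [->|[r /elim_empty_transP e /IH[f fF rf]]].
    case: qF => [qF|[f qf fF]]; first by exists q => //; apply: move_path_nil.
    by exists f => //; apply: closure_move_path.
  exists f => //; case: e => [e|[s ps e]]; first exact: move_path_letter e rf.
  exact: move_path_cat (closure_move_path ps) (move_path_letter e rf).
suff [f fF pf] : exists2 f, f \in nfa_final elim_empty & nfa_path elim_empty p w f.
  by exists p, f.
elim: pq qF {pI} => {p w q} [p|p q w r e _ IH|p a q w r e _ IH] rF.
- by exists p => //; apply/elim_empty_finalP; left.
- have pq : (p, q) \in closure E by apply: sub_bypass.
  (* The empty move is merged with acceptance if no letter remains, and with the first remaining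
     letter otherwise. *)
  have [f] := IH rF; case: w {IH} => [|a w] /=.
    move=> + qf; rewrite -qf => /elim_empty_finalP[qF|[g qg gF]];
      exists p => //; apply/elim_empty_finalP; right; first by exists q.
    by exists g => //; apply: closure_trans qg.
  move=> fF [s qs sf]; exists f => //; exists s => //.
  case/elim_empty_transP: qs => [qs|[u qu us]]; apply/elim_empty_transP; right.
    by exists q.
  by exists u => //; apply: closure_trans qu.
- have [f fF qf] := IH rF; exists f => //; exists q => //.
  by apply/elim_empty_transP; left.
Qed.
End EmptyMoves.

(** * Image of a regular language under a transducer *)

Section Image.
Variables (Sigma : finType) (t : transducer Sigma).

(* In state [(q, u, v)] the transducer still has to read [u] and write [v]
   before it reaches [q]. *)
Let config : Type := (tstate t * seq Sigma * seq Sigma)%type.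

Fixpoint reads (q : tstate t) (u v : seq Sigma) : seq (config * Sigma * config) :=
  if u is a :: u' then ((q, u, v), a, (q, u', v)) :: reads q u' v else [::].

Fixpoint writes (q : tstate t) (v : seq Sigma) : seq (config * Sigma * config) :=
  if v is b :: v' then ((q, [::], v), b, (q, [::], v')) :: writes q v' else [::].

Definition all_reads :=
  flatten [seq reads e.2 e.1.1.2 e.1.2 | e <- ttrans t].
Definition all_writes := flatten [seq writes e.2 e.1.2 | e <- ttrans t].
Definition all_starts : seq (config * config) :=
  [seq ((e.1.1.1, [::], [::]), (e.2, e.1.1.2, e.1.2)) | e <- ttrans t].

Lemma all_readsP e : e \in all_reads ->
  exists q a u v, e = ((q, a :: u, v), a, (q, u, v)).
Proof.
case/flattenP => s /mapP[[[[p u] v] q] _ ->] /=; elim: u => //= a u IH.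
by rewrite inE => /orP[/eqP->|/IH//]; exists q, a, u, v.
Qed.

Lemma all_writesP e : e \in all_writes ->
  exists q b v, e = ((q, [::], b :: v), b, (q, [::], v)).
Proof.
case/flattenP => s /mapP[[[[p u] v] q] _ ->] /=; elim: v => //= b v IH.
by rewrite inE => /orP[/eqP->|/IH//]; exists q, b, v.
Qed.

(** The automaton recognises the output, so reading a letter, which advances [A], and choosing a
    transition of [t], during which [A] waits, are both empty moves; only writing consumes a
    letter. *)
Definition image_empty (A : nfa Sigma) : seq (nat * nat) :=
  [seq (pickle (e.1.1, d.1.1), pickle (e.2, d.2)) |
    e <- all_reads, d <- [seq d <- nfa_trans A | d.1.2 == e.1.2]] ++
  [seq (pickle (e.1, r), pickle (e.2, r)) | e <- all_starts, r <- nfa_states A].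

Definition image_letters (A : nfa Sigma) : seq (nat * Sigma * nat) :=
  [seq (pickle (e.1.1, r), e.1.2, pickle (e.2, r)) |
    e <- all_writes, r <- nfa_states A].

Definition image_ends (P : {set tstate t}) (s : seq nat) : seq nat :=
  [seq pickle ((p, [::], [::]) : config, r) | p <- enum P, r <- s].

Definition nfa_image (A : nfa Sigma) : nfa Sigma :=
  elim_empty (image_empty A) (image_letters A)
    (image_ends (tinit t) (nfa_init A)) (image_ends (tfinal t) (nfa_final A)).

Variable A : nfa Sigma.
Let mpath := move_path (image_empty A) (image_letters A).
Let code (q : tstate t) (u v : seq Sigma) (r : nat) : nat := pickle ((q, u, v), r).

(** The invariant for an arbitrary configuration: what is pending, [u] and [v], comes first in the
    input and the output, and [u'], [v'] label the transitions of [t] still to be chosen. *)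
Lemma image_path_sound x w y : mpath x w y ->
  forall p u v r q s, x = code p u v r -> y = code q [::] [::] s ->
  exists u' v', [/\ w = v ++ v', nfa_path A r (u ++ u') s & tpath p u' v' q].
Proof.
elim=> {x w y} [x|x y w z e _ IH|x b y w z e _ IH] p u v r q s ex ez.
- move: ez; rewrite ex => /(pcan_inj pickleK)[-> -> -> ->].
  by exists [::], [::]; split=> //; apply: tpath_nil.
- move: e; rewrite mem_cat => /orP[] /allpairsPdep[e [d [eR]]].
    case/all_readsP: eR => q' [a [u0 [v0 ->]]]; case: d => -[r1 a1] r2.
    rewrite mem_filter /= => /andP[/eqP-> d] []; rewrite ex.
    move=> /(pcan_inj pickleK)[-> -> -> ->] ey.
    have [u' [v' [-> ? ?]]] := IH _ _ _ _ _ _ ey ez.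
    by exists u', v'; split=> //=; exists r2.
  case/mapP: eR => -[[[p0 u0] v0] q0] e0 -> /= rA []; rewrite ex.
  move=> /(pcan_inj pickleK)[-> -> -> ->] ey.
  have [u' [v' [-> ? ?]]] := IH _ _ _ _ _ _ ey ez.
  by exists (u0 ++ u'), (v0 ++ v'); split=> //; apply: tpath_cons e0 _.
- move: e => /allpairsPdep[e [r' [/all_writesP[q' [b' [v0 ->]]] _ []]]] /=.
  rewrite ex => /(pcan_inj pickleK)[-> -> -> ->] -> ey.
  have [u' [v' [-> ? ?]]] := IH _ _ _ _ _ _ ey ez.
  by exists u', v'.
Qed.

Lemma image_path_writes q v r : {subset writes q v <= all_writes} ->
  r \in nfa_states A -> mpath (code q [::] v r) v (code q [::] [::] r).
Proof.
elim: v => [|b v IH] sub rA; first exact: move_path_nil.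
apply: (move_path_letter (q := code q [::] v r)).
  apply/allpairsPdep; exists ((q, [::], b :: v), b, (q, [::], v)), r.
  by split=> //; apply/sub/mem_head.
by apply: IH => // e ev; apply: sub; rewrite inE ev orbT.
Qed.

Lemma image_path_reads q u v r s : {subset reads q u v <= all_reads} ->
  nfa_path A r u s -> mpath (code q u v r) [::] (code q [::] v s).
Proof.
elim: u r => [|a u IH] r sub /=; first by move=> ->; apply: move_path_nil.
move=> [r' e r's]; apply: (move_path_empty (q := code q u v r')).
  rewrite mem_cat; apply/orP; left; apply/allpairsPdep.
  exists ((q, a :: u, v), a, (q, u, v)), (r, a, r').
  by rewrite mem_filter eqxx; split=> //; apply/sub/mem_head.
by apply: IH => // f fu; apply: sub; rewrite inE fu orbT.
Qed.

(** Each transition of [t] is simulated by choosing it, reading its whole input word and then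
    writing its whole output word. *)
Lemma image_path_complete p x y q r s : tpath p x y q ->
  r \in nfa_states A -> nfa_path A r x s ->
  mpath (code p [::] [::] r) y (code q [::] [::] s).
Proof.
move=> pq; elim: pq r => {p x y q} [p|p u v q x y q' e _ IH] r rA.
  by move=> <-; apply: move_path_nil.
case/nfa_path_cat => r' rr' r's; have r'A := nfa_path_states rA rr'.
apply: (move_path_empty (q := code q u v r)).
  rewrite mem_cat; apply/orP; right; apply/allpairsPdep.
  exists ((p, [::], [::]), (q, u, v)), r; split=> //.
  by apply/mapP; exists (p, u, v, q).
rewrite -[v ++ y]cat0s; apply: (move_path_cat (q := code q [::] v r')).
  apply: image_path_reads rr' => f fu; apply/flattenP.
  by exists (reads q u v) => //; apply/mapP; exists (p, u, v, q).
apply: (move_path_cat (q := code q [::] [::] r')); last exact: IH.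
apply: image_path_writes => // f fu; apply/flattenP.
by exists (writes q v) => //; apply/mapP; exists (p, u, v, q).
Qed.

Lemma lang_nfa_image : lang (nfa_image A) = Defs.image t (lang A).
Proof.
apply/seteqP; split=> y /=.
  move=> /lang_elim_empty[x [z [/allpairsPdep[p [r [pI rI ->]]]]]].
  move=> /allpairsPdep[q [s [qF sF ->]]] pq.
  have [u [v [-> rs ?]]] := image_path_sound pq erefl erefl.
  exists u; first by exists r, s.
  by exists p, q; split=> //; rewrite -mem_enum.
move=> [x [r [s [rI sF rs]]] [p [q [pI qF pq]]]]; apply/lang_elim_empty.
exists (code p [::] [::] r), (code q [::] [::] s); split.
- by apply/allpairsPdep; exists p, r; rewrite mem_enum.
- by apply/allpairsPdep; exists q, s; rewrite mem_enum.
- by apply: image_path_complete rs => //; rewrite mem_cat rI.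
Qed.
End Image.

(** Since [t] is fixed, the lists built from its transitions alone are constants; only the automaton
    varies. *)
Lemma computable_nfa_image (Sigma : finType) (t : transducer Sigma)
    (cT : countType) (A : cT -> nfa Sigma) :
  computable A -> computable (fun c => nfa_image t (A c)).
Proof.
move=> HA; rewrite /nfa_image /elim_empty /closure /unzip1 /bypass.
rewrite /image_empty /image_letters /image_ends /nfa_states.
by prove_nfa_computable.
Qed.

(** * Iterating mu *)

(** Induction on the length of a list containing all predecessors of [w]: for [v] below [w],
    transitivity puts the predecessors of [v] in the same list, and irreflexivity lets [v] be
    removed from it. *)
Lemma word_order_wf (T : finType) (prec : seq T -> seq T -> Prop) :
  word_order prec -> well_founded prec.
Proof.
move=> [irr tr _ fin] w; have /finite_seqP[s ws] := fin w.
have sw v : prec v w -> v \in s.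
  by move=> vw; have : [set` s] v by rewrite -ws.
move: {2}(size s) (leqnn (size s)) => n.
elim: n s w {ws} sw => [|n IH] s w sw sn.
  by constructor=> v /sw; move: sn; rewrite leqn0 size_eq0 => /eqP->.
constructor=> v vw; apply: (IH (rem v s)) => [u uv|]; last first.
  by rewrite size_rem ?sw // -subn1 leq_subLR.
have us := sw u (tr _ _ _ uv vw).
have /perm_mem/(_ u) := perm_to_rem (sw v vw).
rewrite us inE; case: eqP => // uv'.
by case: (irr v); rewrite -{1}uv'.
Qed.

Section Mu.
Variables (Sigma : finType) (t : transducer Sigma) (M : set (seq Sigma)).
Implicit Types X : set (seq Sigma).

Definition nfa_indep (B A : nfa Sigma) : nfa Sigma :=
  nfa_diff (nfa_diff B (nfa_image t A)) (nfa_image (tinv t) A).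

Definition nfa_mu (B A : nfa Sigma) : nfa Sigma :=
  nfa_diff (nfa_indep B A) (nfa_image (tinv t) (nfa_indep B A)).

Lemma lang_nfa_indep B A :
  lang (nfa_indep B A) = indep_words t (lang B) (lang A).
Proof. by rewrite !lang_nfa_diff !lang_nfa_image setDDl. Qed.

Lemma lang_iter_nfa_mu B i A :
  lang (iter i (nfa_mu B) A) = mu_iter t (lang B) i (lang A).
Proof.
rewrite /mu_iter; elim: i => //= i <-.
by rewrite lang_nfa_diff lang_nfa_image lang_nfa_indep.
Qed.

Lemma computable_nfa_mu B : computable (nfa_mu B).
Proof.
suff indepC : computable (nfa_indep B).
  by apply: computable_nfa_diff => //; apply: computable_nfa_image.
apply: computable_nfa_diff; last exact/computable_nfa_image/computable_id.
apply: computable_nfa_diff; first exact: computable_const.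
exact/computable_nfa_image/computable_id.
Qed.

(** The index is fixed outside the algorithm, so each [i] has its own program, a composition of [i]
    copies. *)
Lemma computable_iter_nfa_mu B i : computable (iter i (nfa_mu B)).
Proof.
elim: i => [|i IH]; first exact: computable_id.
exact: computable_comp (computable_nfa_mu B) IH.
Qed.

Lemma independentP X :
  independent t X <-> forall x y, X x -> X y -> ~ realizes t x y.
Proof.
split=> [tX x y Xx Xy xy|tX].
  have : (Defs.image t X `&` X) y by split=> //; exists x.
  by rewrite [_ `&` _]tX.
by apply/seteqP; split=> // y [[x Xx xy] Xy]; apply: tX xy.
Qed.

Lemma sub_indep_words X :
  X `<=` M -> independent t X -> X `<=` indep_words t M X.
Proof.
move=> XM /independentP tX x Xx; split; first exact: XM.
by move=> -[[y Xy]|[y Xy /realizes_tinv]]; apply: tX.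
Qed.

(** An image of a word of [X] lies in [image t X] and hence outside [indep_words t M X], so the
    subtraction in [mu] removes no word of [X]. *)
Lemma sub_mu X : X `<=` M -> independent t X -> X `<=` mu t M X.
Proof.
move=> XM tX x Xx; split; first exact: sub_indep_words.
move=> [y [_ ntX] /realizes_tinv xy].
by apply: ntX; left; exists x.
Qed.

Lemma mu_sub X : mu t M X `<=` M.
Proof. by move=> x [[]]. Qed.

(** Whenever two words of [indep_words t M X] are related by [t], the subtraction in [mu] removes
    the first. *)
Lemma mu_independent X : independent t (mu t M X).
Proof.
apply/independentP => x y [_ ntI] [Iy _] xy; apply: ntI.
by exists y => //; apply/realizes_tinv.
Qed.

Lemma mu_iter_independent i X : X `<=` M -> independent t X ->
  mu_iter t M i X `<=` M /\ independent t (mu_iter t M i X).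
Proof.
by case: i => // i _ _; split; [apply: mu_sub | apply: mu_independent].
Qed.

Lemma sub_mu_iter i X : X `<=` M -> independent t X -> X `<=` mu_iter t M i X.
Proof.
move=> XM tX; elim: i => // i; move/subset_trans; apply.
by have [? ?] := mu_iter_independent i XM tX; apply: sub_mu.
Qed.

Lemma mu_fixpoint_maximal (prec : seq Sigma -> seq Sigma -> Prop) X :
  word_order prec -> input_decreasing prec t -> X `<=` M -> independent t X ->
  mu t M X `<=` X -> maximal_independent t M X.
Proof.
move=> precP dec XM tX muX; split=> // w [Mw nXw] /independentP tXw.
have IX : indep_words t M X w.
  split=> // -[[x Xx]|[x Xx /realizes_tinv]].
    by apply: tXw; [left | right].
  by apply: tXw; [right | left].
(* From here on only membership of [w] in [indep_words t M X] is kept, which makes the induction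
   hypothesis apply to the images of [w]. *)
move: nXw; apply; elim/(well_founded_induction (word_order_wf precP)): w IX
  {Mw tXw} => w IH Iw.
apply: muX; split=> // -[v Iv /realizes_tinv wv].
have Xv : X v by apply: IH Iv; apply: dec.
by case: Iw => _; apply; right; exists v => //; apply/realizes_tinv.
Qed.
End Mu.

Lemma computable_algorithm (aT bT : countType) (P : aT -> Prop)
    (R : aT -> bT -> Prop) (f : aT -> bT) :
  computable f -> (forall x, P x -> R x (f x)) -> algorithm P R.
Proof. by move=> [e He] PR; exists e => x /PR; exists (f x). Qed.

Theorem mainTheorem5 (Sigma : finType) (Sigma_gt0 : 0 < #|Sigma|)
    (prec : seq Sigma -> seq Sigma -> Prop) (prec_order : word_order prec)
    (M : set (seq Sigma)) (M_regular : regular M)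
    (t : transducer Sigma) (t_decreasing : input_decreasing prec t) :
  (forall i : nat, 0 < i ->
     (forall L : set (seq Sigma), regular L -> regular (mu_iter t M i L)) /\
     algorithm (fun A : nfa Sigma => True)
       (fun A B : nfa Sigma => lang B = mu_iter t M i (lang A)))
  /\
  ((exists i : nat, forall L : set (seq Sigma),
      L `<=` M -> independent t L -> mu_star t M L = mu_iter t M i L) ->
   algorithm
     (fun A : nfa Sigma => lang A `<=` M /\ independent t (lang A))
     (fun A B : nfa Sigma =>
        lang A `<=` lang B /\ maximal_independent t M (lang B))).
Proof.
have [B BM] := M_regular; rewrite -BM; split=> [i _|[i stable]].
  split=> [L [A <-]|].
    by exists (iter i (nfa_mu t B) A); apply: lang_iter_nfa_mu.
  apply: computable_algorithm (computable_iter_nfa_mu t B i) _ => A _.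
  exact: lang_iter_nfa_mu.
apply: computable_algorithm (computable_iter_nfa_mu t B i) _ => A [AM tA].
rewrite lang_iter_nfa_mu; split; first exact: sub_mu_iter.
have [XM tX] := mu_iter_independent i AM tA.
apply: (mu_fixpoint_maximal prec_order) => // w muw.
(* A further application of [mu] is the term of index [i.+1] in the union [mu_star], which stability
   identifies with the iterate of index [i]. *)
by rewrite -stable //; exists i.+1.
Qed.
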